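(* Let $R$ be a proper rational fraction of degree $n\ge1$ having no poles on the real semiaxis $\mathbb R^+$, and let $\mu_*$ be the (even) function associated with $R$ as in the context. Then $$\frac{|R(x^2)|^{2m}}{\mu_*(x)}\le\frac m\pi\,\|R\|_{L^{2m}(\mathbb R^+;\frac1{\sqrt x})}^{2m}\qquad\text{for all }x\in\mathbb R,\ m\in\mathbb N.$$ Furthermore, for $0<p<q\le\infty$, with $m_p$ the integer in $\mathbb N\cap[\tfrac p2,1+\tfrac p2)$, $$\|R\|_{L^q(\mathbb R^+;\frac1{\sqrt x})}\le\left(\frac{m_p}{\pi}\,\|\mu_*\|_{L^\infty(\mathbb R^+)}\right)^{\frac1p-\frac1q}\|R\|_{L^p(\mathbb R^+;\frac1{\sqrt x})}.$$ Moreover, if $\delta>0$ and all the poles of $R$ lie in the exterior of the parabola $x=\frac14\frac{y^2}{\delta^2}-\delta^2$ (in the plane of $z=x+iy$), then for $0<p<q\le\infty$ $$\|R\|_{L^q(\mathbb R^+;\frac1{\sqrt x})}\le\left(\frac{2m_p\,n}{\pi\delta}\right)^{\frac1p-\frac1q}\|R\|_{L^p(\mathbb R^+;\frac1{\sqrt x})}.$$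
   Context: A proper rational fraction is a quotient $P/Q$ of polynomials with $\deg P<\deg Q$; its degree is the number of its poles counted with multiplicity. $\mathbb R^+=[0,\infty)$. For $0<p<\infty$, $\|R\|_{L^{p}(\mathbb R^+;\frac1{\sqrt x})}=\left(\int_{\mathbb R^+}\frac{|R(x)|^p}{\sqrt x}\,dx\right)^{1/p}$ (value $+\infty$ allowed); for $p=\infty$ it is $\sup_{\mathbb R^+}|R|$; $1/\infty=0$. Write the pairwise distinct poles of $R$ as $r_ke^{i\varphi_k}$, $r_k>0$, $\varphi_k\in(0,2\pi)$, with multiplicities $n_k$, $k=1,\dots,\nu$, $\sum_{k=1}^\nu n_k=n$. Set $$\mu_*(x)=\sum_{k=1}^{\nu}\left(\frac{n_k\sqrt{r_k}\,\sin(\varphi_k/2)}{|x-\sqrt{r_k}e^{i\varphi_k/2}|^2}+\frac{n_k\sqrt{r_k}\,\sin(\varphi_k/2)}{|x+\sqrt{r_k}e^{-i\varphi_k/2}|^2}\right).$$ The exterior of the parabola is the component of its complement not containing $\mathbb R^+$, i.e. $\{x+iy:\ x<\frac{y^2}{4\delta^2}-\delta^2\}$. *)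

(* Defs.v *)
From mathcomp Require Import all_boot all_order all_algebra.
From mathcomp Require Import all_classical all_reals all_analysis.
From mathcomp.real_closed Require Export complex.
From mathcomp Require Import lra.

Set Implicit Arguments.
Unset Strict Implicit.
Unset Printing Implicit Defensive.

Import Order.TTheory GRing.Theory Num.Theory.
Import numFieldNormedType.Exports.

Local Open Scope classical_set_scope.
Local Open Scope complex_scope.
Local Open Scope ring_scope.

(* The modulus of z as an element of R (the generic `|z| lives in R[i]). *)
Notation cabs := ComplexField.Normc.normc.

Definition cis (R : realType) (t : R) : R[i] := cos t +i* sin t.

(* A rational fraction is given by its numerator P and denominator Q in lowest
   terms; "proper" means deg P < deg Q, which also forces Q != 0. *)
Definition proper_fraction (R : realType) (P Q : {poly R[i]}) : bool :=
  coprimep P Q && (size P < size Q)%N.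

Definition fraction_abs (R : realType) (P Q : {poly R[i]}) (x : R) : R :=
  cabs (P.[x%:C] / Q.[x%:C]).

(* Since P and Q are coprime, the poles of P/Q are the roots of Q, with the
   same multiplicities. *)
Definition poles (R : realType) (Q : {poly R[i]}) : set R[i] :=
  [set z | root Q z].

(* A finite-support sum; [poles Q] is finite as soon as Q != 0. *)
Definition fraction_degree (R : realType) (Q : {poly R[i]}) : nat :=
  \sum_(z \in poles Q) mup z Q.

(* The angle phi in ]0, 2pi[ with z = |z| e^(i phi); meaningful only for z
   off the half-line [0, +oo[, see polar_angleP below. *)
Definition polar_angle (R : realType) (z : R[i]) : R :=
  xget 0 [set phi | 0 < phi < 2 * pi /\ z = (cabs z)%:C * cis phi].

Definition mu_star (R : realType) (Q : {poly R[i]}) (x : R) : R :=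
  \sum_(z \in poles Q)
    let s := Num.sqrt (cabs z) in
    let phi := polar_angle z in
    let k := (mup z Q)%:R in
    (k * s * sin (phi / 2) / cabs (x%:C - s%:C * cis (phi / 2)) ^+ 2
     + k * s * sin (phi / 2) / cabs (x%:C + s%:C * cis (- (phi / 2))) ^+ 2).

Definition half_line (R : realType) : set R := [set` `[0, +oo[].
Arguments half_line R : clear implicits.

Definition sup_norm (R : realType) (f : R -> R) : \bar R :=
  ereal_sup [set (`|f x|)%:E | x in half_line R].

(* The norm of L^p(R^+; 1/sqrt x), 0 < p <= +oo; for p = +oo it is a genuine
   supremum, not an essential one. The value at p = -oo is a dummy. *)
Definition wnorm (R : realType) (p : \bar R) (f : R -> R) : \bar R :=
  match p with
  | p'%:E => poweR (\int[lebesgue_measure]_(x in half_line R)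
               (`|f x| `^ p' / Num.sqrt x)%R%:E)%E p'^-1
  | +oo%E => sup_norm f
  | -oo%E => 0%E
  end.

(* 1/q with the convention 1/+oo = 0. *)
Definition inv_exponent (R : realType) (q : \bar R) : R :=
  if q is q'%:E then q'^-1 else 0.

Definition parabola_exterior (R : realType) (delta : R) : set R[i] :=
  [set z | complex.Re z
           < complex.Im z ^+ 2 / (4 * delta ^+ 2) - delta ^+ 2].

Lemma polar_angleP (R : realType) (z : R[i]) :
  (forall x : R, 0 <= x -> z != x%:C) ->
  0 < polar_angle z < 2 * pi /\ z = (cabs z)%:C * cis (polar_angle z).
Proof.
move=> hz; rewrite /polar_angle; case: xgetP => [phi _ //|nex].
exfalso; case: z hz nex => a b hz nex.
set r := cabs (a +i* b) in nex.
have rE : r ^+ 2 = a ^+ 2 + b ^+ 2.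
  by rewrite /r /= sqr_sqrtr // addr_ge0 // sqr_ge0.
have r0 : 0 < r.
  rewrite lt_def sqrtr_ge0 andbT; apply/eqP => /ComplexField.Normc.eq0_normc e.
  by move: (hz 0 (lexx _)); rewrite e eqxx.
pose c := a / r.
have c2 : c ^+ 2 <= 1.
  by rewrite /c expr_div_n ler_pdivrMr ?exprn_gt0 // mul1r rE lerDl sqr_ge0.
have c1 : -1 <= c <= 1 by rewrite -ler_norml -(@expr_le1 _ 2) // real_normK ?num_real.
have s2 : Num.sqrt (1 - c ^+ 2) = `|b| / r.
  have -> : 1 - c ^+ 2 = (b / r) ^+ 2.
    have r2 : r ^+ 2 != 0 by rewrite expf_neq0 // gt_eqF.
    by rewrite /c !expr_div_n -[1](divff r2) -mulrBl rE addrC addKr.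
  by rewrite sqrtr_sqr normrM normfV (gtr0_norm r0).
have ac : r * cos (acos c) = a.
  by rewrite acosK ?in_itv //= /c mulrC divfK // gt_eqF.
have as_ : r * sin (acos c) = `|b|.
  by rewrite sin_acos // s2 mulrC divfK // gt_eqF.
have := acos_ge0 c1; have := acos_lepi c1; have pi0 := pi_gt0 R.
move=> hpi h0.
have key phi : 0 < phi < 2 * pi -> r * cos phi = a -> r * sin phi = b -> False.
  move=> hphi h1 h2; have : set0 phi; last by [].
  move: nex => /(_ phi); apply; split => //.
  by rewrite /cis /real_complex_def; simpc; rewrite h1 h2.
have [b0|b0] := leP 0 b.
  apply: (key (acos c)) => //; last by rewrite as_ ger0_norm.
  apply/andP; split; last by lra.
  rewrite lt_def h0 andbT; apply/eqP => e.
  move: as_ ac; rewrite e sin0 cos0 mulr0 mulr1 => /esym/eqP.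
  rewrite normr_eq0 => /eqP bz ra.
  have a0 : 0 <= a by rewrite -ra ltW.
  by move: (hz a a0); rewrite bz eqxx.
have an0 : acos c != 0.
  apply/eqP => e; move: as_; rewrite e sin0 mulr0 => /esym/eqP.
  by rewrite normr_eq0 lt_eqF.
apply: (key (2 * pi - acos c)).
- have : 0 < acos c by rewrite lt_def an0.
  by move=> ?; apply/andP; split; lra.
- by rewrite mulr_natl addrC cosD2pi cosN.
- by rewrite mulr_natl addrC sinD2pi sinN mulrN as_ ltr0_norm // opprK.
Qed.

(* Main.v *)
(* Let f(t) = R(t^2)^m, a proper rational function on the line without real poles.
   Replacing the poles in the lower half-plane by their conjugates does not change |f|
   on the line, so f = p / D with all the roots a_j of D in the upper half-plane.
   Splitting off one pole, f(t) = c / (t - a) + (t - a^* ) / (t - a) h(t), the two terms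
   are orthogonal in L^2 because h(t) / (t - a) is O(t^-2) with all its poles on one
   side; by induction and Cauchy-Schwarz,
     |f(x)|^2 <= (1/pi) (\sum_j Im a_j / |x - a_j|^2) \int |f|^2,
   and the sum is m mu_*(x).  The substitution x = t^2 turns the integral into the
   weighted norm.  Bounding |R|^2m by (sup |R|)^(2m-p) |R|^p in the integral, and |R|^q by
   (sup |R|)^(q-p) |R|^p, gives the inequalities between norms.  Finally the parabola is
   the image of the line Im w = delta under w |-> w^2. *)
Require Import Defs.
From mathcomp Require Import all_boot all_order all_algebra.
From mathcomp Require Import all_classical all_reals all_analysis.
From mathcomp Require Import measurable_realfun ring lra zify.

Set Implicit Arguments.
Unset Strict Implicit.
Unset Printing Implicit Defensive.

Import Order.TTheory GRing.Theory Num.Theory.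
Import numFieldNormedType.Exports.

Local Open Scope classical_set_scope.
Local Open Scope complex_scope.
Local Open Scope ring_scope.

(** * Symmetric improper integrals of complex-valued functions *)

Section SymmetricIntegral.
Variable R : realType.
Local Notation C := R[i].
Local Notation Re := (@complex.Re R).
Local Notation Im := (@complex.Im R).
Implicit Types (F G : R -> C) (a b c : C) (s : seq C) (p : {poly C}).

Lemma Re_mul a b : Re (a * b) = Re a * Re b - Im a * Im b.
Proof. by case: a b => [? ?] [? ?]. Qed.

Lemma Im_mul a b : Im (a * b) = Re a * Im b + Im a * Re b.
Proof. by case: a b => [? ?] [? ?]. Qed.

Lemma Re_add a b : Re (a + b) = Re a + Re b.
Proof. by case: a b => [? ?] [? ?]. Qed.

Lemma Im_add a b : Im (a + b) = Im a + Im b.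
Proof. by case: a b => [? ?] [? ?]. Qed.

Lemma Re_opp a : Re (- a) = - Re a.
Proof. by case: a. Qed.

Lemma Im_opp a : Im (- a) = - Im a.
Proof. by case: a. Qed.

Lemma eq_cpx a b : Re a = Re b -> Im a = Im b -> a = b.
Proof. by case: a b => [? ?] [? ?] /= -> ->. Qed.

(** Differentiation is componentwise, so that the real calculus of [is_derive] applies to each
    part. *)
Definition cderive F F' := forall t : R,
  is_derive t 1 (fun u => Re (F u)) (Re (F' t)) /\
  is_derive t 1 (fun u => Im (F u)) (Im (F' t)).

Definition clim F a :=
  (Re (F t) @[t --> +oo] --> Re a) /\ (Im (F t) @[t --> +oo] --> Im a).

(* Only symmetric (principal value) convergence is asked for, so that
   [t |-> 1 / (t - a)] qualifies. *)
Definition csymint F a := exists A, cderive A F /\ clim (fun t => A t - A (- t)) a.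

Lemma cderive_ext F F' G G' : cderive F F' -> F =1 G -> F' =1 G' -> cderive G G'.
Proof. by move=> + /funext <- /funext <-. Qed.

Lemma cderive_cst c : cderive (fun=> c) (fun=> 0).
Proof. by move=> t; split; exact: is_derive_cst. Qed.

Lemma cderiveD F F' G G' : cderive F F' -> cderive G G' ->
  cderive (fun t => F t + G t) (fun t => F' t + G' t).
Proof.
move=> hF hG t; have [f1 f2] := hF t; have [g1 g2] := hG t; split.
  rewrite (_ : (fun u => _) = (fun u => Re (F u)) + (fun u => Re (G u))).
    by rewrite Re_add; exact: is_deriveD.
  by apply/funext => u; rewrite Re_add.
rewrite (_ : (fun u => _) = (fun u => Im (F u)) + (fun u => Im (G u))).
  by rewrite Im_add; exact: is_deriveD.
by apply/funext => u; rewrite Im_add.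
Qed.

Lemma cderiveM F F' G G' : cderive F F' -> cderive G G' ->
  cderive (fun t => F t * G t) (fun t => F t * G' t + F' t * G t).
Proof.
move=> hF hG t; have [f1 f2] := hF t; have [g1 g2] := hG t; split.
  rewrite (_ : (fun u => _) = (fun u => Re (F u)) * (fun u => Re (G u))
     - (fun u => Im (F u)) * (fun u => Im (G u))).
    apply: is_derive_eq; rewrite Re_add !Re_mul /GRing.scale /=.
    by ring.
  by apply/funext => u; rewrite Re_mul.
rewrite (_ : (fun u => _) = (fun u => Re (F u)) * (fun u => Im (G u))
     + (fun u => Im (F u)) * (fun u => Re (G u))).
  apply: is_derive_eq; rewrite Im_add !Im_mul /GRing.scale /=.
  by ring.
by apply/funext => u; rewrite Im_mul.
Qed.

Lemma cderiveZ c F F' : cderive F F' ->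
  cderive (fun t => c * F t) (fun t => c * F' t).
Proof.
move=> hF; apply: (cderive_ext (cderiveM (cderive_cst c) hF)) => // t.
by rewrite mul0r addr0.
Qed.

Lemma cderiveX F F' k : cderive F F' ->
  cderive (fun t => F t ^+ k.+1) (fun t => k.+1%:R * F t ^+ k * F' t).
Proof.
move=> hF; elim: k => [|k IH].
  by apply: (cderive_ext hF) => t; rewrite ?mul1r.
apply: (cderive_ext (cderiveM hF IH)) => t; first by rewrite -exprS.
by rewrite -[k.+2]addn1 natrD exprS; ring.
Qed.

Lemma climD F G a b : clim F a -> clim G b -> clim (fun t => F t + G t) (a + b).
Proof.
move=> [f1 f2] [g1 g2]; split.
  by rewrite Re_add; under eq_fun do rewrite Re_add; exact: cvgD.
by rewrite Im_add; under eq_fun do rewrite Im_add; exact: cvgD.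
Qed.

Lemma climM F G a b : clim F a -> clim G b -> clim (fun t => F t * G t) (a * b).
Proof.
move=> [f1 f2] [g1 g2]; split.
  by rewrite Re_mul; under eq_fun do rewrite Re_mul; apply: cvgB; exact: cvgM.
by rewrite Im_mul; under eq_fun do rewrite Im_mul; apply: cvgD; exact: cvgM.
Qed.

Lemma clim_cst c : clim (fun=> c) c.
Proof. by split; apply: cvg_cst. Qed.

Lemma clim_ext F G a : clim F a -> F =1 G -> clim G a.
Proof. by move=> + /funext <-. Qed.

Lemma csymint_ext F G a b : csymint F a -> F =1 G -> a = b -> csymint G b.
Proof. by move=> + /funext <- <-. Qed.

Lemma csymintD F G a b : csymint F a -> csymint G b ->
  csymint (fun t => F t + G t) (a + b).
Proof.
move=> [A [dA lA]] [B [dB lB]]; exists (fun t => A t + B t); split.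
  exact: cderiveD.
by apply: (clim_ext (climD lA lB)) => t; ring.
Qed.

Lemma csymintZ c F a : csymint F a -> csymint (fun t => c * F t) (c * a).
Proof.
move=> [A [dA lA]]; exists (fun t => c * A t); split; first exact: cderiveZ.
by apply: (clim_ext (climM (clim_cst c) lA)) => t; ring.
Qed.

Lemma csymint0 : csymint (fun=> 0) 0.
Proof.
exists (fun=> 0); split; first exact: cderive_cst.
by apply: (clim_ext (clim_cst 0)) => t; rewrite subr0.
Qed.

(** * The kernel [1 / (t - a)] on the real line *)

Section Kernel.
Variable a : C.
Hypothesis a_neq0 : Im a != 0.
Let x := Re a.
Let y := Im a.
Let den (t : R) := (t - x) ^+ 2 + y ^+ 2.

Let den_gt0 t : 0 < den t.
Proof. by rewrite /den ltr_wpDl ?sqr_ge0// exprn_even_gt0. Qed.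

Lemma Re_inv_sub (t : R) : Re ((t%:C - a)^-1) = (t - x) / den t.
Proof. by rewrite /den /x /y; case: a => u v /=; rewrite sub0r sqrrN. Qed.

Lemma Im_inv_sub (t : R) : Im ((t%:C - a)^-1) = y / den t.
Proof.
by rewrite /den /x /y; case: a => u v /=; rewrite sub0r sqrrN mulNr opprK.
Qed.

Lemma real_sub_neq0 (t : R) : t%:C - a != 0.
Proof.
apply/eqP => /(congr1 Im); rewrite Im_add Im_opp /= sub0r => /eqP.
by rewrite oppr_eq0 (negbTE a_neq0).
Qed.

Let is_derive_den (t : R) : is_derive t 1 den (2 * (t - x)).
Proof.
rewrite (_ : den = (fun u : R => (u - x)) ^+ 2 + cst (y ^+ 2)).
  by apply: is_derive_eq; rewrite /GRing.scale /= ; ring.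
by apply/funext => u.
Qed.

Lemma cderive_inv_sub :
  cderive (fun t => (t%:C - a)^-1) (fun t => - (t%:C - a)^-1 ^+ 2).
Proof.
move=> t; have d0 : den t != 0 by rewrite gt_eqF.
have d1 := is_deriveV d0 (is_derive_den t).
have d2 := d0; rewrite /den in d2.
split.
  rewrite (_ : (fun u => _) = (fun u : R => u - x) * (fun u => (den u)^-1)).
    apply: is_derive_eq; rewrite Re_opp expr2 Re_mul !Re_inv_sub !Im_inv_sub
      /GRing.scale /=.
    by rewrite /den; field.
  by apply/funext => u; rewrite Re_inv_sub.
rewrite (_ : (fun u => _) = cst y * (fun u => (den u)^-1)).
  apply: is_derive_eq; rewrite Im_opp expr2 Im_mul !Re_inv_sub !Im_inv_sub
      /GRing.scale /=.
  by rewrite /den; field.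
by apply/funext => u; rewrite Im_inv_sub.
Qed.

Lemma clim_inv_sub : clim (fun t => (t%:C - a)^-1) 0.
Proof.
(* Both components of the kernel are dominated by [1 / (t - x)] to the right of [x]. *)
have key (f : R -> R) : (forall t, x < t -> `|f t| <= (t - x)^-1) ->
    f t @[t --> +oo] --> 0.
  move=> hf; apply/cvgr0Pnorm_le => e e0; near=> t.
  have xt : x + e^-1 < t by near: t; apply: nbhs_pinfty_gt; exact: num_real.
  have e0' : 0 < e^-1 by rewrite invr_gt0.
  have tx : e^-1 < t - x by rewrite ltrBrDl.
  apply: (le_trans (hf t _)); first by rewrite -subr_gt0 (lt_trans e0').
  by rewrite invf_ple ?posrE ?ltW// (lt_trans e0').
split; apply: key => t xt; have s0 : 0 < t - x by lra.
  rewrite Re_inv_sub ger0_norm; last by rewrite divr_ge0 ?ltW.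
  rewrite ler_pdivrMr// ler_pdivlMl// /den -expr2 lerDl sqr_ge0 //.
rewrite Im_inv_sub normrM normfV (gtr0_norm (den_gt0 t)).
rewrite ler_pdivrMr// ler_pdivlMl// /den.
have aux (u v : R) : u * v <= u ^+ 2 + v ^+ 2.
  by have := sqr_ge0 (u - v); have := sqr_ge0 u; have := sqr_ge0 v; nra.
by rewrite -(real_normK (num_real y)) aux.
Unshelve. all: by end_near. Qed.

End Kernel.

(** Since [1 / (-t - a) = - 1 / (t - (-a))], the behaviour at minus infinity is that of the kernel
    with pole [- a] at plus infinity. *)
Lemma clim_inv_subN a : Im a != 0 -> clim (fun t => ((- t)%:C - a)^-1) 0.
Proof.
move=> a0; have := clim_inv_sub (a := - a); rewrite Im_opp oppr_eq0 => /(_ a0) h.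
have := climM (clim_cst (-1)) h; rewrite mulr0 => /clim_ext; apply => t.
by rewrite mulN1r -invrN opprK opprD -rmorphN.
Qed.

(** The antiderivative is a multiple of [(t - a)^-1 ^+ k.+1], which vanishes at both ends. *)
Lemma csymint_inv_subX a k : Im a != 0 ->
  csymint (fun t => (t%:C - a)^-1 ^+ k.+2) 0.
Proof.
move=> a0; exists (fun t => - (k.+1%:R)^-1 * (t%:C - a)^-1 ^+ k.+1); split.
  apply: (cderive_ext (cderiveZ _ (cderiveX k (cderive_inv_sub a0)))) => // t.
  rewrite -[k.+2]addn2 exprD.
  have k0 : k.+1%:R != 0 :> C by rewrite pnatr_eq0.
  by rewrite mulrN mulrN mulNr opprK !mulrA mulVf// mul1r.
have aux (u : R -> C) : clim u 0 -> clim (fun t => u t ^+ k.+1) 0.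
  move=> hu; elim: k => [//|k IH].
  have := climM hu IH; rewrite mulr0 => /clim_ext; apply => t.
  by rewrite -exprS.
have h := climD (climM (clim_cst (- (k.+1%:R)^-1)) (aux _ (clim_inv_sub a0)))
  (climM (clim_cst ((k.+1%:R)^-1)) (aux _ (clim_inv_subN a0))).
rewrite !mulr0 addr0 in h; apply: (clim_ext h) => t /=.
by rewrite [in RHS]mulNr [in RHS]mulNr opprK mulNr.
Qed.

(** The antiderivative is a branch of log(t - a), up to a constant. Its real part diverges at each
    end, but the values at [t] and [- t] cancel in the limit; its imaginary part increases by [pi]
    in total. *)
Lemma csymint_inv_sub a : 0 < Im a ->
  csymint (fun t => (t%:C - a)^-1) (0 +i* pi).
Proof.
move=> a_gt0; have a_neq0 : Im a != 0 by rewrite gt_eqF.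
pose x := Re a; pose y := Im a.
pose den (u t : R) := (t - u) ^+ 2 + y ^+ 2.
have den_gt0 u t : 0 < den u t.
  by rewrite /den ltr_wpDl ?sqr_ge0// exprn_gt0.
exists (fun t => (ln (den x t) / 2) +i* atan ((t - x) / y)); split.
  move=> t; rewrite Re_inv_sub// Im_inv_sub//=; split.
    have dd : is_derive t 1 (den x) (2 * (t - x)).
      rewrite (_ : den x = (fun u : R => (u - x)) ^+ 2 + cst (y ^+ 2)).
        by apply: is_derive_eq; rewrite /GRing.scale /= ; ring.
      by apply/funext => u.
    have := is_derive1_comp (is_derive1_ln (den_gt0 x t)) dd => d1.
    rewrite (_ : (fun u => _) = 2^-1 \*: (@ln R \o den x)).
      apply: is_derive_eq; rewrite /GRing.scale /=.
      have := gt_eqF (den_gt0 x t); rewrite /den -/x -/y => /negbT ?.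
      by field.
    by apply/funext => u /=; rewrite /GRing.scale/= mulrC.
  have d1 := is_derive1_atan ((t - x) / y).
  have d2 : is_derive t 1 (fun u : R => (u - x) / y) y^-1.
    rewrite (_ : (fun u => _) = y^-1 \*: (fun u : R => u - x)).
      by apply: is_derive_eq; rewrite /GRing.scale /=; ring.
    by apply/funext => u /=; rewrite /GRing.scale/= mulrC.
  have d3 := @is_derive1_comp R atan (fun u : R => (u - x) / y) t _ _ d1 d2.
  rewrite (_ : (fun u => atan _) = atan \o (fun u : R => (u - x) / y))//.
  apply: is_derive_eq.
  have := gt_eqF (den_gt0 x t); rewrite /den -/x -/y => /negbT ?.
  by field; apply/andP; split.
split => /=.
  (* [b] is the mirror image of [a] in the imaginary axis. The quotient [den x t / den (- x) t] is 1
     plus a real combination of the two parts of [1 / (t - b)], hence tends to 1. *)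
  pose b := (- x) +i* y; have b0 : Im b != 0 by [].
  have [l1 l2] := clim_inv_sub b0.
  have e t : den x (- t) = den (- x) t by rewrite /den; ring.
  have lr : 1 - 4 * x * Re ((t%:C - b)^-1) + 4 * x ^+ 2 / y * Im ((t%:C - b)^-1)
      @[t --> +oo] --> (1 : R).
    rewrite -[X in _ --> X]addr0 -[X in _ --> X + _]subr0.
    rewrite -[X in _ --> _ - X + _](mulr0 (4 * x)).
    rewrite -[X in _ --> _ - _ + X](mulr0 (4 * x ^+ 2 / y)).
    by apply: cvgD; [apply: cvgB; [exact: cvg_cst|]|]; apply: cvgM => //; exact: cvg_cst.
  have q t : 1 - 4 * x * Re ((t%:C - b)^-1) + 4 * x ^+ 2 / y * Im ((t%:C - b)^-1)
      = den x t / den (- x) t.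
    rewrite Re_inv_sub// Im_inv_sub// /den -/x -/y /=.
    have := gt_eqF (den_gt0 (- x) t); rewrite /den => /negbT ?.
    by field; apply/andP; split.
  rewrite (funext q) in lr.
  have lln := continuous_cvg _ (continuous_ln ltr01) lr.
  rewrite (_ : (fun t => _) = (fun t => ln (den x t / den (- x) t) * 2^-1)); last first.
    by apply/funext => t /=; rewrite -mulrBl e -ln_div ?posrE.
  rewrite -(mul0r 2^-1); apply: cvgM; last exact: cvg_cst.
  by rewrite -[X in _ --> X](@ln1 R); exact: lln.
have lat u : atan ((t - u) / y) @[t --> +oo] --> (pi / 2 : R).
  apply: (@cvg_comp _ _ _ (fun t => (t - u) / y) _ _ (+oo%R)); last exact: cvgy_atan.
  apply/cvgryPgt => A; near=> t.
  rewrite ltr_pdivlMr// ltrBrDr; near: t; apply: nbhs_pinfty_gt; exact: num_real.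
rewrite (_ : (fun t => _) = (fun t => atan ((t - x) / y) + atan ((t - (- x)) / y))).
  by rewrite [pi]splitr; apply: cvgD.
by apply/funext => t /=; rewrite -atanN -mulNr opprD !opprK.
Unshelve. all: by end_near. Qed.

End SymmetricIntegral.

(** * Rational functions with poles in the upper half-plane *)

Section UpperHalfPlane.
Variable R : realType.
Local Notation C := R[i].
Local Notation Re := (@complex.Re R).
Local Notation Im := (@complex.Im R).
Implicit Types (F G : R -> C) (a b c : C) (s : seq C) (p : {poly C}).

Lemma csymint_conj F a : csymint F a -> csymint (fun t => (F t)^*%C) a^*%C.
Proof.
move=> [A [dA [l1 l2]]]; exists (fun t => (A t)^*%C); split.
  move=> t; have [d1 d2] := dA t; split.
    have -> : (fun u => Re (A u)^*%C) = (fun u => Re (A u)).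
      by apply/funext => u; case: (A u).
    by case: (F t) d1.
  have -> : (fun u => Im (A u)^*%C) = - (fun u => Im (A u)).
    by apply/funext => u; rewrite fctE; case: (A u).
  by apply: (is_derive_eq (is_deriveN d2)); case: (F t).
split.
  have -> : (fun t => Re ((A t)^*%C - (A (- t))^*%C)) = (fun t => Re (A t - A (- t))).
    by apply/funext => t; rewrite -rmorphB; case: (_ - _).
  by case: a l1 {l2}.
have -> : (fun t => Im ((A t)^*%C - (A (- t))^*%C)) = (fun t => - Im (A t - A (- t))).
  by apply/funext => t; rewrite -rmorphB; case: (_ - _).
by case: a {l1} l2 => u v l2; exact: (cvgN l2).
Qed.

Definition upper_half : pred C := fun a => 0 < Im a.
Arguments upper_half : simpl never.

Definition inv_prod s (t : R) : C := \prod_(a <- s) (t%:C - a)^-1.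

Lemma inv_prod_cons a s t : inv_prod (a :: s) t = (t%:C - a)^-1 * inv_prod s t.
Proof. by rewrite /inv_prod big_cons. Qed.

Lemma upper_sub_neq0 a (t : R) : upper_half a -> t%:C - a != 0.
Proof. by rewrite /upper_half => h; apply: real_sub_neq0; rewrite gt_eqF. Qed.

(** Induction by partial fractions. If all poles coincide, the product is a power of the kernel;
    otherwise two distinct poles [a] and [b] are separated, which leaves two products with one
    factor fewer. *)
Lemma csymint_inv_prod s : all upper_half s -> (1 < size s)%N ->
  csymint (inv_prod s) 0.
Proof.
have [n] := ubnP (size s); elim: n s => // n IH [//|a s] ss.
move=> /= /andP[ua us] s0.
have [/all_pred1P e|/allPn[b bs /= ba]] := boolP (all (pred1 a) s).
  rewrite e; case: (size s) s0 => // k _.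
  apply: csymint_ext (csymint_inv_subX k (_ : Im a != 0)) _ erefl.
    by rewrite gt_eqF.
  by move=> t; rewrite inv_prod_cons /inv_prod big_nseq -Monoid.iteropE exprS.
have ub : upper_half b by move/allP : us; apply.
have ps : perm_eq s (b :: rem b s) by exact: perm_to_rem.
have us' : all upper_half (rem b s).
  by apply/allP => z /mem_rem zs; move/allP : us; apply.
have ab : a - b != 0 by rewrite subr_eq0 eq_sym.
have K t : inv_prod (a :: s) t = (a - b)^-1 *
    (inv_prod (a :: rem b s) t + (-1) * inv_prod (b :: rem b s) t).
  rewrite inv_prod_cons [inv_prod s t](perm_big _ ps) -/(inv_prod _ t) !inv_prod_cons.
  have := upper_sub_neq0 t ua; have := upper_sub_neq0 t ub => ? ?.
  by field; apply/and3P; split.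
(* With only two factors, each separated kernel has the nonzero integral [i pi], and the difference
   cancels; with more factors, both integrals vanish by induction. *)
have [s'0|s'0] := posnP (size (rem b s)).
  have h := csymintZ (a - b)^-1 (csymintD (csymint_inv_sub ua)
    (csymintZ (-1) (csymint_inv_sub ub))).
  apply: (csymint_ext h) => [t|]; last by rewrite mulN1r subrr mulr0.
  by rewrite K !inv_prod_cons (size0nil s'0) /inv_prod big_nil !mulr1.
have ssz : size (rem b s) = (size s).-1 by rewrite size_rem.
have [h1 h2] : csymint (inv_prod (a :: rem b s)) 0 /\
     csymint (inv_prod (b :: rem b s)) 0.
  split; apply: IH => //=; rewrite ?ua ?ub ?us' //; move: ss s0 s'0 ssz => /=; lia.
apply: (csymint_ext (csymintZ (a - b)^-1 (csymintD h1 (csymintZ (-1) h2)))) => [t|].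
  by rewrite K.
by rewrite mulr0 addr0 mulr0.
Qed.

(* Newton's interpolation formula reduces the numerator to a constant. *)
Lemma csymint_small_num s p : all upper_half s -> (size p < size s)%N ->
  csymint (fun t => p.[t%:C] * inv_prod s t) 0.
Proof.
elim: s p => // b s IH p /= /andP[ub us] ps.
have [s0|s0] := posnP (size s).
  move: ps; rewrite s0 ltnS leqn0 size_poly_eq0 => /eqP ->.
  by apply: (csymint_ext (csymint0 R)) => // t; rewrite horner0 mul0r.
pose q := p %/ ('X - b%:P).
have pE : p = q * ('X - b%:P) + (p.[b])%:P by rewrite -modp_XsubC -divp_eq.
have qs : (size q < size s)%N.
  rewrite size_divp ?polyXsubC_eq0// size_XsubC subn1.
  by move: ps; rewrite ltnS; case: (size p).
have h : csymint (inv_prod (b :: s)) 0 by apply: csymint_inv_prod => //=; rewrite ub.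
apply: (csymint_ext (csymintD (IH q us qs) (csymintZ p.[b] h))) => [t|].
  rewrite {2}pE !hornerE inv_prod_cons mulrDl; congr (_ + _).
  by rewrite -mulrA; congr (_ * _); rewrite mulrA mulfV ?mul1r// upper_sub_neq0.
by rewrite mulr0 addr0.
Qed.

End UpperHalfPlane.
Arguments upper_half : simpl never.

(** * The pointwise bound *)

Section PointwiseBound.
Variable R : realType.
Local Notation C := R[i].
Local Notation Re := (@complex.Re R).
Local Notation Im := (@complex.Im R).
Implicit Types (a b c z : C) (s : seq C) (p q : {poly C}).

Lemma sqr_cabs z : (cabs z ^+ 2)%:C = z * z^*%C.
Proof. by rewrite rmorphXn /= -sqr_normc. Qed.

Lemma conjc_real_sub (t : R) a : (t%:C - a)^*%C = t%:C - a^*%C.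
Proof. by case: a => u v; apply: eq_cpx => //=; rewrite !sub0r. Qed.

Lemma conjcM a b : (a * b)^*%C = a^*%C * b^*%C.
Proof. exact: rmorphM. Qed.

Lemma conjcD a b : (a + b)^*%C = a^*%C + b^*%C.
Proof. exact: rmorphD. Qed.

Lemma cabs_ge0 z : 0 <= cabs z.
Proof. by case: z => u v; exact: sqrtr_ge0. Qed.

Lemma cabs_gt0 z : z != 0 -> 0 < cabs z.
Proof.
move=> z0; rewrite lt_def cabs_ge0 andbT; apply: contraNneq z0.
by move/ComplexField.Normc.eq0_normc => ->.
Qed.

Lemma cabs_conj z : cabs z^*%C = cabs z.
Proof. by case: z => u v /=; rewrite sqrrN. Qed.

(** On the real line [|t - a|^-2] is the difference of the kernel and its conjugate, divided by
    [2 i Im a]; the numerator integrates to [2 i pi]. *)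
Lemma csymint_inv_sub_sqr a : upper_half a ->
  csymint (fun t => (cabs (t%:C - a)^-1 ^+ 2)%:C) (pi / Im a)%:C.
Proof.
move=> ua; have h := csymint_inv_sub ua.
have da : a - a^*%C != 0.
  rewrite subr_eq0; apply/eqP => /(congr1 Im); move: ua; rewrite /upper_half.
  by case: a {h} => u v /=; lra.
have h2 := csymintD h (csymintZ (-1) (csymint_conj h)).
apply: (csymint_ext (csymintZ (a - a^*%C)^-1 h2)).
  move=> t; rewrite sqr_cabs conjc_inv conjc_real_sub.
  have := upper_sub_neq0 t ua => ta.
  have ta' : t%:C - a^*%C != 0.
    by rewrite -conjc_real_sub conjc_eq0.
  by field; apply/and3P; split.
have -> : a - a^*%C = (2 * Im a) *i by case: a {h h2 da ua} => u v; apply: eq_cpx => /=; ring.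
have a0 : Im a != 0 by rewrite gt_eqF.
by apply: eq_cpx; rewrite ?Re_mul ?Im_mul /=; field.
Qed.

(** Each pole adds an orthogonal component, of squared norm [|c|^2 pi / Im a], to [I] and one term
    to the kernel sum; Cauchy-Schwarz combines the two. The bound on [size p] expresses decay at
    infinity and forces [p = 0] when there are no poles. *)
Lemma pointwise_bound s p : all (@upper_half R) s -> (size p <= size s)%N ->
  exists I : R,
  [/\ 0 <= I,
      csymint (fun t => (cabs (p.[t%:C] * inv_prod s t) ^+ 2)%:C) I%:C &
      forall x, cabs (p.[x%:C] * inv_prod s x) ^+ 2 <=
                I / pi * \sum_(a <- s) Im a / cabs (x%:C - a) ^+ 2].
Proof.
elim: s p => [|a s IH] p.
  rewrite leqn0 size_poly_eq0 => _ /eqP ->; exists 0; split => //.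
    apply: (csymint_ext (csymint0 R)) => // t.
    by rewrite horner0 mul0r ComplexField.Normc.normc0 expr0n.
  by move=> x; rewrite horner0 mul0r ComplexField.Normc.normc0 expr0n !mul0r.
move=> /= /andP[ua us] ps.
have nz0 z : z \in s -> a^*%C - z != 0.
  move=> zs; apply/eqP => /(congr1 Im); rewrite Im_add Im_opp.
  have : upper_half z by move/allP : us; apply.
  by move: ua; rewrite /upper_half; case: (a) (z) => ? ? [? ?] /=; lra.
pose D := \prod_(z <- s) ('X - z%:P).
have Da0 : D.[a^*%C] != 0.
  rewrite horner_prod prodf_seq_neq0; apply/allP => z zs /=.
  by rewrite hornerXsubC nz0.
(* With this [c], the polynomial [p - c *: D] vanishes at the conjugate of [a], which is no root of
   [D] because it lies in the lower half-plane. *)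
have [c cE] : exists c, p.[a^*%C] = c * D.[a^*%C].
  by exists (p.[a^*%C] / D.[a^*%C]); rewrite divfK.
pose q := (p - c *: D) %/ ('X - (a^*%C)%:P).
have pE : p = c *: D + q * ('X - (a^*%C)%:P).
  have : ('X - (a^*%C)%:P) %| p - c *: D.
    by rewrite dvdp_XsubCl rootE hornerD hornerN hornerZ cE subrr.
  by move/divpK; rewrite -/q => ->; rewrite addrC subrK.
have sq : (size q <= size s)%N.
  have : (size (p - c *: D)%R <= (size s).+1)%N.
    rewrite (leq_trans (size_polyD p (- (c *: D))))// size_polyN geq_max ps.
    by rewrite (leq_trans (size_scale_leq c D))// size_prod_XsubC.
  by rewrite size_divp ?polyXsubC_eq0// size_XsubC /= subn1; case: (size _).
have [I [I0 hI bI]] := IH q us sq.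
have Ds t : D.[t%:C] * inv_prod s t = 1.
  rewrite horner_prod /inv_prod -big_split big_seq big1//= => z zs.
  rewrite hornerXsubC mulfV// upper_sub_neq0//.
  by move/allP : us; apply.
have ta' (t : R) : t%:C - a^*%C != 0.
  by rewrite -conjc_real_sub conjc_eq0 upper_sub_neq0.
have dec t : p.[t%:C] * inv_prod (a :: s) t = c * (t%:C - a)^-1 +
    (t%:C - a^*%C) / (t%:C - a) * (q.[t%:C] * inv_prod s t).
  rewrite pE hornerD hornerZ hornerM hornerXsubC inv_prod_cons.
  rewrite -[c * (t%:C - a)^-1]mulr1 -[X in _ = _ * X + _](Ds t).
  by ring.
have pa0 : 0 < pi / Im a by rewrite divr_gt0 ?pi_gt0.
exists (cabs c ^+ 2 * (pi / Im a) + I); split.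
- by rewrite addr_ge0// mulr_ge0 ?sqr_ge0 ?ltW.
(* Since [(t - conj a) / (t - a)] is unimodular, the cross terms of the expanded square are
   [conj c * h / (t - a)], where [h = q / D], and its conjugate. Both integrate to 0. *)
- have h0 : csymint (fun t => q.[t%:C] * inv_prod (a :: s) t) 0.
    by apply: csymint_small_num => //=; rewrite ua.
  have h1 := csymint_conj h0.
  have := csymintD (csymintD (csymintZ (c * c^*%C) (csymint_inv_sub_sqr ua)) hI)
   (csymintD (csymintZ c^*%C h0) (csymintZ c h1)).
  move/csymint_ext; apply => [t|].
    rewrite dec !sqr_cabs !inv_prod_cons.
    set h := q.[_] * inv_prod s t.
    rewrite [q.[_] * (_ * _)]mulrCA -/h -!conjc_real_sub.
    have := ta' t; rewrite -conjc_real_sub; have := upper_sub_neq0 t ua.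
    move: h (t%:C - a) => h z ? ?.
    by rewrite !(conjcD, conjcM, conjc_inv, conjcK); field; apply/andP; split.
  by rewrite conjc0 !mulr0 !addr0 -sqr_cabs -rmorphM -rmorphD.
move=> x; rewrite dec big_cons; have := bI x.
set h := q.[_] * _; set S := \sum_(z <- s) _ => hS.
have r0 : 0 < cabs (x%:C - a) by rewrite cabs_gt0// upper_sub_neq0.
have e1 : cabs ((x%:C - a^*%C) / (x%:C - a)) = 1.
  rewrite -conjc_real_sub.
  by rewrite ComplexField.Normc.normcM ComplexField.Normc.normcV cabs_conj divff// gt_eqF.
set u := c * _; set v := _ * h.
have uE : cabs u = cabs c / cabs (x%:C - a).
  by rewrite ComplexField.Normc.normcM ComplexField.Normc.normcV.
have vE : cabs v = cabs h by rewrite ComplexField.Normc.normcM e1 mul1r.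
have tri : cabs (u + v) <= cabs u + cabs v by exact: le_normcD.
have S0 : 0 <= S.
  rewrite /S big_seq; apply: sumr_ge0 => z zs; rewrite divr_ge0 ?sqr_ge0//.
  by apply/ltW; move/allP : us; apply.
apply: (@le_trans _ _ ((cabs u + cabs v) ^+ 2)).
  by rewrite ler_pXn2r// nnegrE ?addr_ge0 ?cabs_ge0.
rewrite vE uE.
have amgm (X Y w : R) : 0 <= X -> 0 <= Y -> 0 <= w -> w ^+ 2 <= X * Y -> 2 * w <= X + Y.
  move=> X0 Y0 w0 hw; rewrite -(@ler_pXn2r _ 2) ?nnegrE ?addr_ge0 ?mulr_ge0//.
  by have := sqr_ge0 (X - Y); nra.
move: hS r0; set r := cabs (x%:C - a); set k := cabs c; set w := cabs h => hS r0.
have k0 : 0 <= k := cabs_ge0 _.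
have w0 : 0 <= w := cabs_ge0 _.
move: (pi) (Im a) (pi_gt0 R) (ua : 0 < Im a) hS => P y P0 y0 hS.
(* The cross term in Cauchy-Schwarz: the summands on the right have product
   [(k / r)^2 * (I / P * S)], and [w^2 <= I / P * S] is the induction hypothesis. *)
have cross : 2 * (k / r * w) <= k ^+ 2 / y * S + I / P * y / r ^+ 2.
  apply: amgm.
  - by rewrite mulr_ge0// divr_ge0 ?sqr_ge0// ltW.
  - by rewrite divr_ge0 ?sqr_ge0// mulr_ge0 ?divr_ge0// ltW.
  - by rewrite mulr_ge0// divr_ge0// ltW.
  - rewrite exprMn [X in _ <= X](_ : _ = (k / r) ^+ 2 * (I / P * S)).
      by rewrite ler_wpM2l ?sqr_ge0.
    by field; rewrite !lt0r_neq0.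
rewrite (_ : _ / P * _ = k ^+ 2 / y * S + I / P * y / r ^+ 2 + (k / r) ^+ 2 + I / P * S).
  by rewrite sqrrD -mulr_natl; lra.
by field; rewrite !lt0r_neq0.
Qed.

End PointwiseBound.

(** * Square roots of the poles *)

Section HalfLinePoles.
Variable R : realType.
Local Notation C := R[i].
Local Notation Re := (@complex.Re R).
Local Notation Im := (@complex.Im R).
Implicit Types (a b c z : C) (r s : seq C) (P Q p q : {poly C}).

(** The square root of [z] in the upper half-plane: off the half-line, half the angle lies strictly
    between 0 and [pi]. *)
Definition half_root z : C :=
  (Num.sqrt (cabs z))%:C * cis (polar_angle z / 2).

Lemma Im_opp_conj z : Im (- z^*%C) = Im z.
Proof. by case: z => u v; rewrite /= opprK. Qed.

Lemma upper_half_opp_conj z : upper_half (- z^*%C) = upper_half z.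
Proof. by rewrite /upper_half Im_opp_conj. Qed.

Definition off_half_line : pred C := fun z => ~~ ((0 <= Re z) && (Im z == 0)).

Lemma off_half_line_neq z : off_half_line z -> forall x : R, 0 <= x -> z != x%:C.
Proof.
move=> hz x x0; apply: contraNneq hz => ->.
by rewrite /= x0 eqxx.
Qed.

Lemma Im_half_rootE z :
  Im (half_root z) = Num.sqrt (cabs z) * sin (polar_angle z / 2).
Proof. by rewrite /half_root Im_mul /= mul0r addr0. Qed.

Lemma half_root_sqr z : off_half_line z -> half_root z ^+ 2 = z.
Proof.
move=> /off_half_line_neq/polar_angleP[_ zE].
rewrite [RHS]zE /half_root exprMn -rmorphXn /= sqr_sqrtr ?cabs_ge0//.
congr (_ * _); set phi := polar_angle z.
rewrite {2}(_ : phi = phi / 2 + phi / 2); last by field.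
by apply: eq_cpx; rewrite expr2 ?Re_mul ?Im_mul /= ?cosD ?sinD; ring.
Qed.

Lemma half_root_upper z : off_half_line z -> upper_half (half_root z).
Proof.
move=> hz; have [phi2 _] := polar_angleP (off_half_line_neq hz).
have z0 : z != 0 by apply: (off_half_line_neq hz) (lexx 0).
rewrite /upper_half Im_half_rootE mulr_gt0 ?sqrtr_gt0 ?cabs_gt0//.
by rewrite sin_gt0_pi//; move: phi2 => /andP[? ?]; apply/andP; split; lra.
Qed.

(** The poles of R(t^2) are [w] and [- w] with [w = half_root z]; the lower one is replaced by its
    conjugate, so that both lie in the upper half-plane. *)
Definition line_poles s : seq C :=
  flatten [seq [:: half_root z; - (half_root z)^*%C] | z <- s].

Lemma line_poles_upper s : all off_half_line s -> all (@upper_half R) (line_poles s).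
Proof.
move=> hs; apply/allP => a /flatten_mapP[z zs]; have hz := allP hs z zs.
by rewrite !inE => /orP[] /eqP ->; rewrite ?upper_half_opp_conj half_root_upper.
Qed.

Lemma size_line_poles s : size (line_poles s) = (2 * size s)%N.
Proof. by elim: s => //= z s; rewrite -/(line_poles s) => ->; lia. Qed.

(** A bridge from the finite-support sums defining [mu_star] and [fraction_degree] to sums over a
    list of roots repeated by multiplicity. *)
Lemma sum_poles_mup (V : nmodType) (F : C -> V) Q s : Q != 0 ->
  Q = lead_coef Q *: \prod_(z <- s) ('X - z%:P) ->
  \sum_(z \in poles Q) F z *+ mup z Q = \sum_(z <- s) F z.
Proof.
move=> Q0 QE.
have l0 : lead_coef Q != 0 by rewrite lead_coef_eq0.
have rootQ z : root Q z = (z \in s) by rewrite QE rootZ// root_prod_XsubC.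
have mupQ z : mup z Q = count_mem z s.
  rewrite QE -mul_polyC mupMr ?mu_prod_XsubC//.
  by rewrite rootC.
have -> : poles Q = [set` undup s].
  by apply/seteqP; split => z; rewrite /poles /= rootQ mem_undup.
rewrite -fsbig_seq ?undup_uniq// -[RHS]big_undup_iterop_count.
by apply: eq_bigr => z _; rewrite mupQ.
Qed.

(** Both numerators in [mu_star] equal the imaginary part of [half_root z] times the multiplicity,
    and the denominators are squared distances to the two line poles of [z]. *)
Lemma mu_starE Q s (x : R) : Q != 0 ->
  Q = lead_coef Q *: \prod_(z <- s) ('X - z%:P) ->
  mu_star Q x = \sum_(a <- line_poles s) Im a / cabs (x%:C - a) ^+ 2.
Proof.
move=> Q0 QE; rewrite big_flatten big_map; under eq_bigr do rewrite big_cons big_seq1.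
rewrite -(sum_poles_mup _ Q0 QE).
have conjE z : (Num.sqrt (cabs z))%:C * cis (- (polar_angle z / 2)) = (half_root z)^*%C.
  by rewrite /half_root; apply: eq_cpx; rewrite /= cosN sinN; ring.
rewrite /mu_star; apply: eq_fsbigr => z _; cbv beta zeta.
rewrite conjE -/(half_root z) -[RHS]mulr_natl mulrDr !mulrA.
by rewrite Im_opp_conj Im_half_rootE !mulrA opprK.
Qed.

End HalfLinePoles.
Arguments half_root : simpl never.

(** * The weighted integral on the half-line *)

Section HalfLineIntegral.
Variable R : realType.
Local Notation C := R[i].
Local Notation Re := (@complex.Re R).
Local Notation Im := (@complex.Im R).
Implicit Types (P Q p : {poly C}) (f : R -> R).

Local Notation mu := (@lebesgue_measure R).

Lemma measurable_half_line : measurable (half_line R).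
Proof. exact: measurable_itv. Qed.

(** The substitution x = t^2 is performed on compact intervals away from the singularity of the
    weight at 0; nonnegativity of the integrand bounds each piece by the whole integral, and limits
    are taken afterwards. *)
Lemma le_half_line_integral f (A : R -> R) (I : R) :
  measurable_fun setT f -> (forall x, 0 <= f x) ->
  (forall x, 0 < x -> {for x, continuous f}) ->
  (forall t : R, is_derive t 1 A (f (t ^+ 2))) ->
  (A t - A (- t) @[t --> +oo] --> I) ->
  (I%:E <= \int[mu]_(x in half_line R) (f x / Num.sqrt x)%:E)%E.
Proof.
move=> mf f0 cf dA lA.
set J := (\int[mu]_(x in _) _)%E.
pose G t := A t - A (- t).
have FTC e T : 0 < e -> e < T -> ((G T - G e)%:E <= J)%E.
  move=> e0 eT.
  have T0 : 0 < T by exact: lt_trans eT.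
  have e2T2 : e ^+ 2 < T ^+ 2 by rewrite ltr_pXn2r ?nnegrE// ltW.
  (* The two branches of the square root each contribute [f x / (2 * Num.sqrt x)] to the derivative
     of [B]. *)
  pose B x := A (Num.sqrt x) - A (- Num.sqrt x).
  have dB (x : R) : 0 < x -> is_derive x 1 B (f x / Num.sqrt x).
    move=> x0; have s0 : Num.sqrt x != 0 by rewrite lt0r_neq0 ?sqrtr_gt0.
    have d1 := is_derive1_sqrt x0.
    have d2 := is_derive1_comp (dA (Num.sqrt x)) d1.
    have d3 : is_derive x 1 (fun x => - Num.sqrt x) (- (2 * Num.sqrt x)^-1).
      exact: is_deriveN.
    have d4 := @is_derive1_comp R A (fun x => - Num.sqrt x) x _ _ (dA (- Num.sqrt x)) d3.
    have := is_deriveB d2 d4 => d5.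
    apply: (is_derive_eq d5).
    by rewrite sqrrN sqr_sqrtr ?ltW//; field.
  have itv_gt0 x : x \in `[e ^+ 2, T ^+ 2] -> 0 < x.
    by rewrite in_itv /= => /andP[+ _]; apply: lt_le_trans; rewrite exprn_gt0.
  have sub : `[e ^+ 2, T ^+ 2] `<=` half_line R.
    by move=> x /itv_gt0 x0; rewrite /half_line /= in_itv /= andbT ltW.
  have ctsB x : x \in `[e ^+ 2, T ^+ 2] -> {for x, continuous B}.
    move=> /itv_gt0 x0; apply: differentiable_continuous.
    by apply/derivable1_diffP; have ? := dB _ x0; exact: ex_derive.
  have -> : (G T - G e)%:E =
      (\int[mu]_(x in `[(e ^+ 2)%R, (T ^+ 2)%R]) (f x / Num.sqrt x)%:E)%E.
    rewrite (@continuous_FTC2 _ _ B) //.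
    - by rewrite /B !sqrtr_sqr !gtr0_norm.
    - apply: continuous_in_subspaceT => x; rewrite inE => /itv_gt0 x0.
      apply: cvgM; first exact: cf.
      apply: cvgV; first by rewrite lt0r_neq0 ?sqrtr_gt0.
      exact: sqrt_continuous.
    - split.
      + move=> x xi; have x0 : 0 < x by apply: itv_gt0; apply: subset_itv_oo_cc.
        by have ? := dB _ x0; exact: ex_derive.
      + apply: cvg_at_right_filter; apply: ctsB.
        by rewrite in_itv /= lexx ltW.
      + apply: cvg_at_left_filter; apply: ctsB.
        by rewrite in_itv /= lexx ltW.
    - move=> x xi; have x0 : 0 < x by apply: itv_gt0; apply: subset_itv_oo_cc.
      by rewrite derive1E; have := dB _ x0 => ?; rewrite derive_val.
  apply: ge0_subset_integral => //; first exact: measurable_half_line.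
    apply/measurable_EFinP; apply: measurable_funM.
      exact: (measurable_funS _ _ mf).
    rewrite (_ : (fun x => _) = (fun x : R => Num.sqrt x `^ (-1))).
      apply: (measurableT_comp (measurable_powR _)).
      apply: measurable_funS (continuous_measurable_fun (@sqrt_continuous R)) => //.
    by apply/funext => x; rewrite powR_inv1.
  by move=> x _; rewrite lee_fin divr_ge0 ?sqrtr_ge0.
have cA : continuous A.
  move=> t; apply: differentiable_continuous.
  by apply/derivable1_diffP; exact: ex_derive.
move: FTC; case: J => [j||] FTC.
- rewrite lee_fin.
  (* As [e] tends to 0 from the right, [G e] tends to [G 0 = 0]. *)
  have GT T : 0 < T -> G T <= j.
    move=> T0; apply: (@cvgr_to_le _ (0^'+) _ _ (fun e => G T - G e)).
      have : G T - G e @[e --> 0^'+] --> G T - G 0.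
        apply: cvgB; first exact: cvg_cst.
        apply: cvg_at_right_filter; apply: cvgB; first exact: cA.
        apply: (@continuous_comp _ _ _ -%R A); first exact: opp_continuous.
        exact: cA.
      have -> : G 0 = 0 by rewrite /G oppr0 subrr.
      by rewrite subr0.
    near=> e; rewrite -lee_fin; apply: FTC; near: e.
      exact: nbhs_right_gt.
    exact: nbhs_right_lt.
  apply: (cvgr_to_le lA); near=> T; apply: GT; near: T.
  exact: nbhs_pinfty_gt.
- exact: leey.
- by have := FTC 1 2 ltr01 (ltr1n _ 2); rewrite leeNy_eq.
Unshelve. all: by end_near. Qed.

(** On the real line [|P|^2] is a real polynomial, the sum of the squares of the two parts of [P];
    continuity and measurability of the modulus follow. *)
Lemma cabs_hornerE P : exists2 q : {poly R}, (forall x, 0 <= q.[x]) &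
  forall x, cabs P.[x%:C] = Num.sqrt q.[x].
Proof.
have [u [v uv]] : exists u v : {poly R}, forall x, P.[x%:C] = u.[x] +i* v.[x].
  elim/poly_ind: P => [|p c [u [v uv]]].
    by exists 0, 0 => x; rewrite !horner0.
  exists (u * 'X + (Re c)%:P), (v * 'X + (Im c)%:P) => x.
  by rewrite !hornerE uv; apply: eq_cpx; rewrite ?Re_add ?Im_add ?Re_mul ?Im_mul /=; ring.
exists (u ^+ 2 + v ^+ 2) => x; last by rewrite uv !hornerE.
by rewrite !hornerE addr_ge0 ?sqr_ge0.
Qed.

Lemma fraction_absE P Q (x : R) : fraction_abs P Q x = cabs P.[x%:C] / cabs Q.[x%:C].
Proof.
by rewrite /fraction_abs ComplexField.Normc.normcM ComplexField.Normc.normcV.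
Qed.

Lemma fraction_abs_ge0 P Q (x : R) : 0 <= fraction_abs P Q x.
Proof. exact: cabs_ge0. Qed.

Lemma continuous_cabs_horner P : continuous (fun x : R => cabs P.[x%:C]).
Proof.
have [q _ qE] := cabs_hornerE P; rewrite (funext qE) => x.
apply: continuous_comp; [exact: continuous_horner|exact: sqrt_continuous].
Qed.

Lemma measurable_fraction_abs P Q : measurable_fun setT (fraction_abs P Q).
Proof.
rewrite (funext (fraction_absE P Q)); apply: measurable_funM.
  exact: (continuous_measurable_fun (continuous_cabs_horner (P:=P))).
rewrite (_ : (fun x => _) = (fun x : R => cabs Q.[x%:C] `^ (-1))).
  apply: (measurableT_comp (measurable_powR _)).
  exact: (continuous_measurable_fun (continuous_cabs_horner (P:=Q))).
by apply/funext => x; rewrite powR_inv1 ?cabs_ge0.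
Qed.

Lemma continuous_fraction_abs P Q (x : R) : ~~ root Q x%:C ->
  {for x, continuous (fraction_abs P Q)}.
Proof.
move=> Qx; rewrite (funext (fraction_absE P Q)); apply: cvgM.
  exact: continuous_cabs_horner.
apply: cvgV; last exact: continuous_cabs_horner.
by rewrite lt0r_neq0 ?cabs_gt0.
Qed.

End HalfLineIntegral.

(** * Inequalities between weighted norms *)

Lemma powRK_inv (R : realType) (x r : R) : 0 <= x -> 0 < r -> (x `^ r) `^ r^-1 = x.
Proof. by move=> x0 r0; rewrite -powRrM mulfV ?gt_eqF// powRr1. Qed.

Lemma powRVK_inv (R : realType) (x r : R) : 0 <= x -> 0 < r -> (x `^ r^-1) `^ r = x.
Proof. by move=> x0 r0; rewrite -powRrM mulVf ?gt_eqF// powRr1. Qed.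

Section Nikolskii.
Variable R : realType.
Local Notation mu := (@lebesgue_measure R).
Variable f : R -> R.
Hypothesis f_ge0 : forall x, 0 <= f x.
Hypothesis f_meas : measurable_fun setT f.

Let W (r : R) := (\int[mu]_(x in half_line R) (`|f x| `^ r / Num.sqrt x)%:E)%E.

Let W_ge0 r : (0 <= W r)%E.
Proof.
by apply: integral_ge0 => x _; rewrite lee_fin divr_ge0 ?powR_ge0 ?sqrtr_ge0.
Qed.

Let W_meas r : measurable_fun (half_line R) (fun x => (`|f x| `^ r / Num.sqrt x)%:E).
Proof.
apply/measurable_EFinP; apply: measurable_funM.
  apply: (measurable_funS measurableT) => //.
  apply: (measurableT_comp (measurable_powR r)).
  exact: (measurableT_comp (@normr_measurable R setT)).
rewrite (_ : (fun x => _) = (fun x : R => Num.sqrt x `^ (-1))).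
  apply: (measurableT_comp (measurable_powR _)).
  exact: (measurable_funS _ _ (continuous_measurable_fun (@sqrt_continuous R))).
by apply/funext => x; rewrite powR_inv1.
Qed.

Lemma expe_wnorm k : (0 < k)%N -> (wnorm (k%:R)%:E f ^+ k = W k%:R)%E.
Proof.
move=> k0; rewrite /wnorm -/(W _).
have k0R : (k%:R : R) != 0 by rewrite pnatr_eq0 -lt0n.
have := W_ge0 k%:R; case: (W k%:R) => [w||//].
  rewrite lee_fin => w0; rewrite poweR_EFin -EFin_expe -powR_mulrn ?powR_ge0//.
  by rewrite -powRrM mulVf// powRr1.
move=> _; rewrite poweRyr ?invr_neq0//.
by case: k k0 {k0R} => // k _; elim: k => // k IH; rewrite expeS IH.
Qed.

Variable S : R.
Hypothesis f_le : forall x, half_line R x -> f x <= S.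

Lemma W_le (a b : R) : 0 < a -> a <= b -> (W b <= (S `^ (b - a))%:E * W a)%E.
Proof.
move=> a0 ab; rewrite /W -ge0_integralZl; first last.
- by rewrite lee_fin powR_ge0.
- by move=> x _; rewrite lee_fin divr_ge0 ?powR_ge0 ?sqrtr_ge0.
- exact: W_meas.
- exact: measurable_half_line.
apply: ge0_le_integral; first exact: measurable_half_line.
- by move=> x _; rewrite lee_fin divr_ge0 ?powR_ge0 ?sqrtr_ge0.
- exact: W_meas.
- apply: emeasurable_funM; last exact: W_meas.
  exact: measurable_cst.
- move=> x hx; rewrite -EFinM lee_fin mulrA ler_wpM2r ?invr_ge0 ?sqrtr_ge0//.
  rewrite ger0_norm//.
  have -> : f x `^ b = f x `^ (b - a) * f x `^ a.
    by rewrite -powRD subrK// gt_eqF// (lt_le_trans a0).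
  rewrite ler_wpM2r ?powR_ge0// ge0_ler_powR ?subr_ge0 ?nnegrE//.
    by rewrite (le_trans (f_ge0 x))// f_le.
  exact: f_le.
Qed.

End Nikolskii.

(** With [S] the supremum of [f], the hypothesis gives [S^(2m) <= K * S^(2m - p) * W p]. Boundedness
    makes [S] finite, so a power of it can be cancelled to reach [S^p <= K * W p]; every exponent
    [q] then follows by interpolation between [p] and infinity. *)
Lemma nikolskii (R : realType) (f : R -> R) (K : R) (m : nat) (p : R) (q : \bar R) :
  (forall x, 0 <= f x) -> measurable_fun setT f ->
  (exists B, forall x, half_line R x -> f x <= B) ->
  0 < K -> 0 < p -> p <= (2 * m)%:R -> (p%:E < q)%E ->
  (forall x, half_line R x -> ((f x ^+ (2 * m))%:E <=
     K%:E * \int[lebesgue_measure]_(x in half_line R)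
        (`|f x| `^ (2 * m)%:R / Num.sqrt x)%:E)%E) ->
  (wnorm q f <= (K `^ (p^-1 - inv_exponent q))%:E * wnorm p%:E f)%E.
Proof.
move=> f0 mf [B fB] K0 p0 p2m pq fK.
have h0 : half_line R 0 by rewrite /half_line /= in_itv /= lexx.
have [S SE] : exists S, sup_norm f = S%:E.
  have up : (sup_norm f <= B%:E)%E.
    apply: ge_ereal_sup => _ [x hx <-]; rewrite lee_fin ger0_norm//; exact: fB.
  have dn : ((f 0)%:E <= sup_norm f)%E.
    by apply: ereal_sup_ubound; exists 0 => //; rewrite ger0_norm.
  by case: (sup_norm f) up dn => // S _ _; exists S.
have fS x : half_line R x -> f x <= S.
  move=> hx; rewrite -lee_fin -SE; apply: ereal_sup_ubound.
  by exists x => //; rewrite ger0_norm.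
have S0 : 0 <= S := le_trans (f0 0) (fS 0 h0).
pose W (r : R) := (\int[lebesgue_measure]_(x in half_line R)
        (`|f x| `^ r / Num.sqrt x)%:E)%E.
have Wle a b : 0 < a -> a <= b -> (W b <= (S `^ (b - a))%:E * W a)%E.
  exact: W_le.
have Wp0 : (0 <= W p)%E.
  by apply: integral_ge0 => x _; rewrite lee_fin divr_ge0 ?powR_ge0 ?sqrtr_ge0.
rewrite [wnorm p%:E f]/wnorm -/(W p).
(* If the integral is infinite, so is the right-hand side, because a power of [K] is positive. *)
case WpE : (W p) Wp0 => [j||//]; last first.
  by move=> _; rewrite poweRyr ?invr_neq0 ?gt_eqF// gt0_muley ?lte_fin ?powR_gt0// leey.
rewrite lee_fin => j0.
have SpK : S `^ p <= K * j.
  (* The case [S = 0] is treated apart, since [S^(2m - p)] is cancelled below. *)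
  move: S0; rewrite le_eqVlt => /orP[/eqP <-|S0].
    by rewrite powR0 ?gt_eqF// mulr_ge0// ltW.
  have m0 : (0 < 2 * m)%N by rewrite -(ltr0n R); exact: lt_le_trans p2m.
  have m0R : 0 < (2 * m)%:R :> R by rewrite ltr0n.
  pose L := K * (S `^ ((2 * m)%:R - p) * j).
  have L0 : 0 <= L by rewrite /L mulr_ge0 ?mulr_ge0 ?powR_ge0// ltW.
  have fL x : half_line R x -> f x ^+ (2 * m) <= L.
    move=> hx; rewrite -lee_fin; apply: (le_trans (fK x hx)).
    rewrite /L EFinM lee_pmul2l ?lte_fin//.
    by have := Wle _ _ p0 p2m; rewrite WpE -EFinM.
  have SL : S <= L `^ ((2 * m)%:R^-1).
    rewrite -lee_fin -SE; apply: ge_ereal_sup => _ [x hx <-].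
    rewrite lee_fin ger0_norm// -[leLHS](powRK_inv _ m0R)//.
    rewrite ge0_ler_powR ?nnegrE ?powR_ge0 ?invr_ge0 ?ler0n//.
    by rewrite powR_mulrn// fL.
  have : S `^ (2 * m)%:R <= L.
    rewrite -[L](powRVK_inv _ m0R)//.
    by rewrite ge0_ler_powR ?nnegrE ?powR_ge0 ?ler0n ?(ltW S0).
  have -> : S `^ (2 * m)%:R = S `^ ((2 * m)%:R - p) * S `^ p.
    by rewrite -powRD subrK// gt_eqF ?implybT// ?S0 ?implybT.
  by rewrite /L mulrCA ler_pM2l// powR_gt0.
have Kj0 : 0 <= K * j by rewrite mulr_ge0// ltW.
case: q pq => [q||//] pq.
- rewrite lte_fin in pq.
  have q0 : 0 < q := lt_trans p0 pq.
  rewrite /wnorm -/(W q) /=.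
  have Wq : (W q <= ((K * j) `^ ((q - p) / p) * j)%:E)%E.
    apply: (le_trans (Wle _ _ p0 (ltW pq))); rewrite WpE -EFinM lee_fin.
    rewrite ler_wpM2r// [_ / p]mulrC.
    have -> : S `^ (q - p) = (S `^ p) `^ (p^-1 * (q - p)).
      by rewrite -powRrM mulrA mulfV ?mul1r ?gt_eqF.
    by rewrite ge0_ler_powR ?nnegrE ?powR_ge0// mulr_ge0 ?invr_ge0 ?subr_ge0// ltW.
  apply: (@le_trans _ _ (poweR ((K * j) `^ ((q - p) / p) * j)%:E q^-1)).
    apply: gt0_ler_poweR => //.
    + by rewrite invr_ge0 ltW.
    + rewrite in_itv /= leey andbT.
      by apply: integral_ge0 => x _; rewrite lee_fin divr_ge0 ?powR_ge0 ?sqrtr_ge0.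
    + by rewrite in_itv /= leey andbT lee_fin mulr_ge0 ?powR_ge0.
  rewrite !poweR_EFin -EFinM lee_fin [(K * j) `^ _]powRM ?(ltW K0)// -mulrA.
  have e1 : j `^ ((q - p) / p) * j = j `^ (q / p).
    rewrite -{2}[j]powRr1// -powRD.
      by congr powR; field; rewrite gt_eqF.
    rewrite (_ : _ + 1 = q / p); last by field; rewrite gt_eqF.
    by rewrite gt_eqF// divr_gt0.
  rewrite e1 powRM ?powR_ge0// -!powRrM.
  rewrite (_ : (q - p) / p / q = p^-1 - q^-1); last by field; rewrite !gt_eqF.
  by rewrite (_ : q / p / q = p^-1)//; field; rewrite !gt_eqF.
- rewrite [wnorm +oo f]SE /inv_exponent subr0 poweR_EFin -EFinM lee_fin -powRM ?(ltW K0)//.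
  rewrite -[S](powRK_inv _ p0)//.
  by rewrite ge0_ler_powR ?nnegrE ?powR_ge0 ?invr_ge0 ?(ltW p0).
Qed.

(** * The fraction P / Q *)

Section Fraction.
Variable R : realType.
Local Notation C := R[i].
Local Notation Re := (@complex.Re R).
Local Notation Im := (@complex.Im R).
Local Notation mu := (@lebesgue_measure R).
Implicit Types (a z : C) (x : R).

Lemma cabs_exp z k : cabs (z ^+ k) = cabs z ^+ k.
Proof.
elim: k => [|k IH]; first by rewrite !expr0 ComplexField.Normc.normc1.
by rewrite !exprS ComplexField.Normc.normcM IH.
Qed.

Lemma inv_prod_rep (s : seq C) k t : inv_prod (flatten (nseq k s)) t = inv_prod s t ^+ k.
Proof.
elim: k => [|k IH]; first by rewrite /inv_prod big_nil expr0.
by rewrite exprS -IH /inv_prod /= big_cat.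
Qed.

(** With [w = half_root z], [x^2 - z = (x - w)(x + w)], and for real [x] conjugating [x + w] does
    not change its modulus. *)
Lemma cabs_inv_prod_line_poles (s : seq C) x : all (@off_half_line R) s ->
  cabs (inv_prod (line_poles s) x) =
  cabs (\prod_(z <- s) ('X - z%:P)).[(x ^+ 2)%:C]^-1.
Proof.
elim: s => [_|z s IH /= /andP[hz hs]].
  by rewrite /inv_prod !big_nil hornerC invr1.
rewrite big_cons hornerM hornerXsubC invfM ComplexField.Normc.normcM -IH//.
rewrite (_ : line_poles (z :: s) =
  half_root z :: - (half_root z)^*%C :: line_poles s)//.
rewrite !inv_prod_cons !ComplexField.Normc.normcM mulrA; congr (_ * _).
have -> : x%:C - - (half_root z)^*%C = (x%:C - - half_root z)^*%C.
  by rewrite conjc_real_sub [in RHS](rmorphN (@conjc R)).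
rewrite !ComplexField.Normc.normcV cabs_conj -invfM -ComplexField.Normc.normcM.
congr (cabs _)^-1.
by rewrite opprK -subr_sqr half_root_sqr// rmorphXn.
Qed.

Lemma kernel_le_inv a x : upper_half a -> Im a / cabs (x%:C - a) ^+ 2 <= (Im a)^-1.
Proof.
move=> ua; have a0 : 0 < Im a := ua.
rewrite ler_pdivrMr; last by rewrite exprn_gt0 ?cabs_gt0 ?upper_sub_neq0.
rewrite ler_pdivlMl// -expr2.
case: a {ua} a0 => u v /= v0.
by rewrite sqr_sqrtr ?addr_ge0 ?sqr_ge0// sub0r sqrrN lerDr sqr_ge0.
Qed.

Lemma half_root_parabola z delta : 0 < delta -> off_half_line z ->
  parabola_exterior delta z -> delta < Im (half_root z).
Proof.
move=> d0 hz; have := half_root_sqr hz; have := half_root_upper hz.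
case: (half_root z) => u v; rewrite /upper_half /= => v0 <-; rewrite /parabola_exterior /=.
rewrite (_ : u * v + v * u = 2 * u * v); last by ring.
move=> h; rewrite ltNge; apply/negP => vd.
have {}h : (u * u - v * v + delta ^+ 2) * (4 * delta ^+ 2) < (2 * u * v) ^+ 2.
  by rewrite -ltr_pdivlMr ?mulr_gt0 ?exprn_gt0// -ltrBrDr.
(* With [w = u + i v], the exterior condition on [w^2] factors into this inequality, whose second
   factor is nonnegative; hence [v <= delta] is impossible. *)
have : (delta ^+ 2 - v ^+ 2) * (u ^+ 2 + delta ^+ 2) < 0 by nra.
apply/negP; rewrite -leNgt; apply: mulr_ge0; last by rewrite addr_ge0 ?sqr_ge0.
rewrite subr_ge0.
by rewrite ler_pXn2r ?nnegrE ?(ltW v0) ?(ltW d0).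
Qed.

Variables (P Q : {poly C}) (s : seq C).
Hypothesis Q0 : Q != 0.
Hypothesis QE : Q = lead_coef Q *: \prod_(z <- s) ('X - z%:P).
Hypothesis s_gt0 : (0 < size s)%N.
Hypothesis sizeP : (size P <= size s)%N.
Hypothesis s_off : all (@off_half_line R) s.

Lemma mu_star_gt0 x : 0 < mu_star Q x.
Proof.
have ge0 a : a \in line_poles s -> 0 < Im a / cabs (x%:C - a) ^+ 2.
  move=> ai; have ua := allP (line_poles_upper s_off) a ai.
  by rewrite divr_gt0 ?exprn_gt0 ?cabs_gt0 ?upper_sub_neq0.
have : (0 < size (line_poles s))%N by rewrite size_line_poles muln_gt0.
rewrite (mu_starE x Q0 QE); case: (line_poles s) ge0 => // a r ge0 _.
rewrite big_cons ltr_pwDl ?ge0 ?mem_head// big_seq sumr_ge0// => b br.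
by rewrite ltW// ge0// in_cons br orbT.
Qed.

Lemma mu_star_le_inv x : mu_star Q x <= \sum_(a <- line_poles s) (Im a)^-1.
Proof.
rewrite (mu_starE x Q0 QE) big_seq [leRHS]big_seq; apply: ler_sum => a ai.
by apply: kernel_le_inv; exact: (allP (line_poles_upper s_off)).
Qed.

Lemma mu_star_le_parabola delta x : 0 < delta ->
  poles Q `<=` parabola_exterior delta -> mu_star Q x <= 2 * (size s)%:R / delta.
Proof.
move=> d0 hQ; apply: (le_trans (mu_star_le_inv x)).
apply: (@le_trans _ _ (\sum_(a <- line_poles s) delta^-1)).
  rewrite big_seq [leRHS]big_seq; apply: ler_sum => a /flatten_mapP[z zs] ai.
  have Ima : Im a = Im (half_root z).
    by move: ai; rewrite !inE => /orP[] /eqP ->; rewrite ?Im_opp_conj.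
  have hz := allP s_off z zs.
  rewrite Ima lef_pV2 ?posrE//; last exact: half_root_upper.
  apply: ltW; apply: half_root_parabola => //; apply: hQ.
  by rewrite /poles /= QE rootZ ?lead_coef_eq0// root_prod_XsubC.
rewrite big_const_seq count_predT size_line_poles iter_addr_0.
by rewrite -[leLHS]mulr_natl natrM.
Qed.

Lemma root_off_half_line x : 0 <= x -> ~~ root Q x%:C.
Proof.
move=> x0; rewrite QE rootZ ?lead_coef_eq0// root_prod_XsubC.
by apply/negP => /(allP s_off); rewrite /off_half_line /= x0 eqxx.
Qed.

(** The bound of [pointwise_bound] for R(t^2)^m. The same [I] is below the weighted integral and
    controls the values, so the two facts can be used separately. *)
Lemma fraction_bound m : (0 < m)%N -> exists I : R,
  [/\ 0 <= I,
     (I%:E <= \int[mu]_(x in half_line R)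
        (`|fraction_abs P Q x| `^ (2 * m)%:R / Num.sqrt x)%:E)%E &
     forall x, fraction_abs P Q (x ^+ 2) ^+ (2 * m) <= m%:R / pi * I * mu_star Q x].
Proof.
move=> m0.
(* [inv_prod] inverts a monic polynomial, so the leading coefficient of [Q] moves to the numerator;
   the exponent [m] repeats each line pole [m] times. *)
pose p := ((lead_coef Q)^-1 *: P \Po 'X^2) ^+ m.
pose us := flatten (nseq m (line_poles s)).
have l0 : lead_coef Q != 0 by rewrite lead_coef_eq0.
have uus : all (@upper_half R) us.
  rewrite /us; elim: (m) => //= k IH; rewrite all_cat IH line_poles_upper//.
have pus : (size p <= size us)%N.
  have -> : size us = (m * (2 * size s))%N.
    by rewrite /us; elim: (m) => //= k IH; rewrite size_cat IH size_line_poles mulSn.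
  rewrite (leq_trans (size_poly_exp_leq _ _))//.
  (* Composition with ['X^2] at most doubles the degree. Thus [p] has degree at most
     [2 m (size s - 1)], and the extra 1 in its size still fits into [2 m * size s]. *)
  have s1 : ((size ((lead_coef Q)^-1 *: P \Po 'X^2)).-1 <= (size P).-1 * 2)%N.
    have := size_comp_poly_leq ((lead_coef Q)^-1 *: P) ('X^2).
    by rewrite size_polyXn /= size_scale ?invr_eq0//; case: (size (_ \Po _)).
  move: s1; set k := (size (_ \Po _)).-1 => s1.
  have : (k * m <= ((size s).-1 * 2) * m)%N.
    rewrite leq_mul2r (leq_trans s1) ?orbT// leq_mul2r /=.
    by move: sizeP; case: (size P) (size s) => [|?] [|?].
  move: s_gt0 m0; case: (size s) => // j _; case: (m) => // i _ /=; lia.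
have ratio x : cabs (p.[x%:C] * inv_prod us x) = fraction_abs P Q (x ^+ 2) ^+ m.
  rewrite /p /us inv_prod_rep horner_exp -exprMn cabs_exp; congr (_ ^+ m).
  rewrite ComplexField.Normc.normcM cabs_inv_prod_line_poles// -ComplexField.Normc.normcM.
  rewrite horner_comp hornerZ hornerXn /fraction_abs -rmorphXn.
  by rewrite [in RHS]QE hornerZ invfM mulrCA mulrA.
have [I [I0 [A0 [dA [lA _]]] bI]] := pointwise_bound uus pus.
pose f x := fraction_abs P Q x ^+ (2 * m).
have sq x : cabs (p.[x%:C] * inv_prod us x) ^+ 2 = f (x ^+ 2).
  by rewrite ratio -exprM mulnC.
exists I; split => //.
  have mf : measurable_fun setT f.
    by apply: measurable_funX; exact: measurable_fraction_abs.
  rewrite [leRHS](_ : _ = \int[mu]_(x in half_line R) (f x / Num.sqrt x)%:E)%E; last first.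
    by apply: eq_integral => x _; rewrite ger0_norm ?powR_mulrn ?fraction_abs_ge0.
  apply: (@le_half_line_integral R f (fun t => Re (A0 t)) I mf).
  - by move=> x; rewrite exprn_ge0 ?fraction_abs_ge0.
  - move=> x x0.
    apply: (@continuous_comp _ _ _ (fraction_abs P Q) (fun y : R => y ^+ (2 * m)));
      last exact: exprn_continuous.
    by apply: continuous_fraction_abs; rewrite root_off_half_line ?ltW.
  - by move=> t; have [d _] := dA t; rewrite -sq.
  - rewrite (_ : (fun t => _) = (fun t => Re (A0 t - A0 (- t))))//.
    by apply/funext => t; rewrite Re_add Re_opp.
move=> x; rewrite -/(f _) -sq; apply: (le_trans (bI x)).
have -> : \sum_(a <- us) Im a / cabs (x%:C - a) ^+ 2 = m%:R * mu_star Q x.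
  rewrite (mu_starE x Q0 QE) /us; elim: (m) => /= [|k IH].
    by rewrite big_nil mul0r.
  by rewrite big_cat /= IH -[in RHS]natr1 mulrDl mul1r addrC.
by rewrite le_eqVlt; apply/orP; left; apply/eqP; ring.
Qed.

(** Stated for an arbitrary bound [M] of [mu_star], to serve both norm inequalities: the supremum
    for the first, [2 n / delta] for the second. *)
Lemma fraction_nikolskii (M p : R) (q : \bar R) (m : nat) :
  (forall x, half_line R x -> mu_star Q x <= M) ->
  0 < p -> (p%:E < q)%E -> p / 2 <= m%:R ->
  (wnorm q (fraction_abs P Q) <=
   ((m%:R / pi * M) `^ (p^-1 - inv_exponent q))%:E * wnorm p%:E (fraction_abs P Q))%E.
Proof.
move=> muM p0 pq pm.
have half_line_sqr y : half_line R y -> (Num.sqrt y ^+ 2 = y) * half_line R (Num.sqrt y).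
  rewrite /half_line /= !in_itv /= !andbT => y0.
  by rewrite sqr_sqrtr// sqrtr_ge0.
have M0 : 0 < M.
  by apply: lt_le_trans (mu_star_gt0 0) (muM 0 _); rewrite /half_line /= in_itv /= lexx.
have m0R : 0 < m%:R :> R by apply: lt_le_trans pm; rewrite divr_gt0.
have m0 : (0 < m)%N by rewrite -(ltr0n R).
apply: (@nikolskii _ _ _ m) => //.
- exact: fraction_abs_ge0.
- exact: measurable_fraction_abs.
(* Boundedness of the fraction comes from its own pointwise bound with [m = 1]; the summand 1 turns
   a bound on the square into one on the value, as [y <= 1 + y^2]. *)
- have [I [I0 _ bI]] := fraction_bound (ltn0Sn 0).
  exists (1 + 1%:R / pi * I * M) => y hy; have [ye hs] := half_line_sqr y hy.
  have := bI (Num.sqrt y); rewrite ye muln1 => b.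
  have : fraction_abs P Q y ^+ 2 <= 1%:R / pi * I * M.
    apply: (le_trans b); rewrite ler_wpM2l ?muM//.
    by rewrite mulr_ge0 ?divr_ge0 ?pi_ge0.
  have := sqr_ge0 (fraction_abs P Q y - 1); have := fraction_abs_ge0 P Q y; nra.
- by rewrite mulr_gt0 ?divr_gt0 ?pi_gt0.
- by rewrite natrM; lra.
- move=> y hy; have [I [I0 IW bI]] := fraction_bound m0; have [ye hs] := half_line_sqr y hy.
  have c0 : 0 < m%:R / pi * M by rewrite mulr_gt0 ?divr_gt0 ?pi_gt0.
  apply: (@le_trans _ _ ((m%:R / pi * M)%:E * I%:E)%E); last by rewrite lee_pmul2l ?lte_fin.
  rewrite -EFinM lee_fin -[in leLHS]ye; apply: (le_trans (bI _)).
  rewrite [leRHS]mulrAC ler_wpM2l ?muM//.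
  by rewrite mulr_ge0 ?divr_ge0 ?pi_ge0.
Qed.

End Fraction.

Theorem theorem5p1 (R : realType) (n : nat) (P Q : {poly R[i]})
  (hn : (1 <= n)%N)
  (hPQ : proper_fraction P Q)
  (hdeg : fraction_degree Q = n)
  (hpoles : forall x : R, half_line R x -> ~ poles Q x%:C) :
  [/\ forall (m : nat) (x : R), (1 <= m)%N ->
        ((fraction_abs P Q (x ^+ 2) ^+ (2 * m) / mu_star Q x)%:E
         <= (m%:R / pi)%:E
            * wnorm ((2 * m)%:R)%:E (fraction_abs P Q) ^+ (2 * m))%E,
      forall (p : R) (q : \bar R) (mp : nat), 0 < p -> (p%:E < q)%E ->
        p / 2 <= mp%:R < 1 + p / 2 ->
        (wnorm q (fraction_abs P Q)
         <= poweR ((mp%:R / pi)%:E * sup_norm (mu_star Q))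
                  (p^-1 - inv_exponent q)
            * wnorm p%:E (fraction_abs P Q))%E
    & forall delta : R, 0 < delta ->
        poles Q `<=` parabola_exterior delta ->
        forall (p : R) (q : \bar R) (mp : nat), 0 < p -> (p%:E < q)%E ->
        p / 2 <= mp%:R < 1 + p / 2 ->
        (wnorm q (fraction_abs P Q)
         <= ((2 * mp%:R * n%:R / (pi * delta)) `^ (p^-1 - inv_exponent q))%:E
            * wnorm p%:E (fraction_abs P Q))%E].

Proof.
have [cPQ sPQ] := andP hPQ.
have Q0 : Q != 0 by rewrite -size_poly_gt0 (leq_ltn_trans _ sPQ).
have [s QE] := closed_field_poly_normal Q.
have l0 : lead_coef Q != 0 by rewrite lead_coef_eq0.
(* The degree is the sum of the constant 1 over the list of roots with repetition. *)
have sn : size s = n.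
  rewrite -hdeg -[LHS]sum1_size; apply: esym.
  apply: (etrans _ (sum_poles_mup (fun=> 1%N) Q0 QE)).
  by apply: eq_fsbigr => z _; rewrite natn.
have sizeP : (size P <= size s)%N.
  by move: sPQ; rewrite {1}QE size_scale// size_prod_XsubC ltnS.
have s0 : (0 < size s)%N by rewrite sn.
have s_off : all (@off_half_line R) s.
  apply/allP => z zs; apply/negP => /andP[rz /eqP iz].
  apply: (hpoles (complex.Re z)); first by rewrite /half_line /= in_itv /= andbT.
  have -> : (complex.Re z)%:C = z by apply: eq_cpx.
  by rewrite /poles /= QE rootZ// root_prod_XsubC.
have nik := fraction_nikolskii Q0 QE s0 sizeP s_off.
have mu0 x := mu_star_gt0 Q0 QE s0 s_off x.
have f0 := fraction_abs_ge0 P Q.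
split.
- move=> m x m0; have [I [I0 IW bI]] := fraction_bound Q0 QE s0 sizeP s_off m0.
  rewrite expe_wnorm ?muln_gt0//.
  have c0 : (0 : R) < m%:R / pi by rewrite divr_gt0 ?pi_gt0 ?ltr0n.
  apply: (@le_trans _ _ ((m%:R / pi)%:E * I%:E)%E); last by rewrite lee_pmul2l ?lte_fin.
  by rewrite -EFinM lee_fin ler_pdivrMr.
- move=> p q mp p0 pq /andP[pm _].
  have h0 : half_line R 0 by rewrite /half_line /= in_itv /= lexx.
  (* The supremum of [mu_star] is finite: each kernel term is at most [(Im a)^-1]. *)
  have [M ME] : exists M, sup_norm (mu_star Q) = M%:E.
    have up : (sup_norm (mu_star Q) <= (\sum_(a <- line_poles s) (complex.Im a)^-1)%:E)%E.
      apply: ge_ereal_sup => _ [x _ <-]; rewrite lee_fin gtr0_norm//.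
      exact: mu_star_le_inv.
    have dn : ((mu_star Q 0)%:E <= sup_norm (mu_star Q))%E.
      by apply: ereal_sup_ubound; exists 0 => //; rewrite gtr0_norm.
    by case: (sup_norm _) up dn => // M _ _; exists M.
  rewrite ME -EFinM poweR_EFin; apply: nik => // x hx.
  rewrite -lee_fin -ME; apply: ereal_sup_ubound.
  by exists x => //; rewrite gtr0_norm.
- move=> delta d0 hd p q mp p0 pq /andP[pm _].
  (* This isolates the bound [2 n / delta] of [mu_star]: each of the [n] poles gives two line poles,
     each contributing at most [1 / delta]. *)
  have -> : 2 * mp%:R * n%:R / (pi * delta) = mp%:R / pi * (2 * n%:R / delta).
    by have := pi_gt0 R; move: (pi) => ? ?; field; rewrite !lt0r_neq0.
  apply: nik => // x _; rewrite -sn; exact: mu_star_le_parabola.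
Qed.
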